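(* Let $\mathcal C=(F_v,F_e,\mathcal T)$ be a crystal framework in $\mathbb R^d$ with motif $\mathcal M=(F_v,F_e)$, and let $g\mapsto T_g$ be the representation of the space group $\mathcal G(\mathcal C)$ as isometries of $\mathbb R^d$. (a) For the rigidity matrix transformation $R(\mathcal C):\mathcal H_v\to\mathcal H_e$, $$\rho_e(g)R(\mathcal C)=R(\mathcal C)\tilde\rho_v(g),\quad g\in\mathcal G(\mathcal C).$$ (b) Let $\mathcal G\subseteq\mathcal G(\mathcal C)$ be a subgroup of semiseparable symmetries. Then, for the affinely periodic rigidity matrix $R(\mathcal M,\mathbb R^{d^2})$, $$\pi_e(g)R(\mathcal M,\mathbb R^{d^2})=R(\mathcal M,\mathbb R^{d^2})\pi_v(g),\quad g\in\mathcal G,$$ where $\pi_e$ is the edge class representation of $\mathcal G$ in $\mathbb R^{|F_e|}$ induced by $\rho_e$ and $\pi_v$ is the representation of $\mathcal G$ in $(\mathbb R^{|F_v|}\otimes\mathbb R^d)\oplus\mathbb R^{d^2}$ induced by $\tilde\rho_v$.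
   Context: A full rank translation group on $\mathbb R^d$ is a set $\mathcal T=\{T_k:k\in\mathbb Z^d\}$ of translations with $T_{k+l}=T_kT_l$ whose period vectors $a_i=T_{\gamma_i}0$ ($\gamma_1,\dots,\gamma_d$ the standard basis) are linearly independent. $Z$ is the invertible matrix with $Z\gamma_i=a_i$, so $T_kx=x+Zk$. A crystal framework $\mathcal C=(F_v,F_e,\mathcal T)$ in $\mathbb R^d$ is a countable bar-joint framework (framework points in $\mathbb R^d$ together with framework edges, which are line segments of positive length joining certain pairs of framework points) whose framework points are $p_{\kappa,k}=T_kp_{\kappa,0}$, $1\le\kappa\le t$, $k\in\mathbb Z^d$, such that $F_v=\{p_{\kappa,0}\}$, $F_e$ is a finite set of framework edges, the set of framework points is the disjoint union of the $T_k(F_v)$ and the set of framework edges is the disjoint union of the $T_k(F_e)$. The edge $T_ke$, $e\in F_e$, is labelled $(e,k)$. A motif edge is written $e=[p_{\kappa,l},p_{\tau,l'}]$ with edge vector $v_e=p_{\kappa,l}-p_{\tau,l'}$ and exponent $\delta(e)=l'-l=(\delta_1,\dots,\delta_d)$. $\mathcal H_v=\prod_{\kappa,k}\mathbb R^d$ and $\mathcal H_e=\prod_{e\in F_e,k\in\mathbb Z^d}\mathbb R$. The infinite rigidity matrix $R(\mathcal C):\mathcal H_v\to\mathcal H_e$ has, in the row for $(e,k)$, the entries of $v_e$ in the $d$ columns of the first endpoint $(\kappa,l+k)$ of $T_ke$, those of $-v_e$ in the $d$ columns of the second endpoint $(\tau,l'+k)$, and zeros elsewhere. The matrix $R(\mathcal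 M,\mathbb R^{d^2})$ is the $|F_e|\times(d|F_v|+d^2)$ matrix whose row for $e$ has $v_e$ in the $d$ columns for $\kappa$, $-v_e$ in the $d$ columns for $\tau$ (zero in these columns if $\kappa=\tau$), zeros in the other vertex columns, and $(\delta_1v_e,\dots,\delta_dv_e)$ in the last $d^2$ columns. The space group $\mathcal G(\mathcal C)$ is the group of isometries of $\mathbb R^d$ mapping $\mathcal C$ to itself, viewed abstractly, $T_g$ being the isometry corresponding to $g$. It acts on vertex labels by $p_{g\cdot(\kappa,k)}=T_g(p_{\kappa,k})$, and correspondingly on edge labels, $(e,k)\mapsto g\cdot(e,k)$. An element $g$ is semiseparable if there is an induced action $\kappa\mapsto g\cdot\kappa$ on the motif vertices, so that $g\cdot(\kappa,k)=(g\cdot\kappa,k')$, where $k'$ may depend on $g,\kappa,k$. $\tilde\rho_v$ is the representation of $\mathcal G(\mathcal C)$ by affine maps of $\mathcal H_v$, $(\tilde\rho_v(g)u)_{\kappa,k}=T_g(u_{g^{-1}\cdot(\kappa,k)})$; $\rho_e$ is the linear representation on $\mathcal H_e$, $(\rho_e(g)w)_{e,k}=w_{g^{-1}\cdot(e,k)}$. Products in the equations denote composition of maps. $\mathcal H_v^{\rm aff}$ is the subspace of $\mathcal H_v$ of vectors $\tilde u_{\kappa,k}=u_\kappa-AZk$ with $u\in\mathbb R^{d|F_v|}$, $A\in M_d(\mathbb R)$; for semiseparable $g$ it is invariant under $\tilde\rho_v(g)$. Let $D:\mathcal H_v^{\rm aff}\to\mathbb R^{d|F_v|}\oplus\mathbb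 R^{d^2}$, $D\tilde u=(u,AZ)$, with $AZ$ written as its $d$ columns in order; then $\pi_v(g)=D\,\tilde\rho_v(g)|_{\mathcal H_v^{\rm aff}}D^{-1}$. The space $\mathcal H_e^{\rm per}\subset\mathcal H_e$ of periodic vectors ($w_{e,k}=w_{e,0}$ for all $k$) is identified with $\mathbb R^{|F_e|}$ by $w\mapsto(w_{e,0})_{e\in F_e}$, and $\pi_e(g)$ is the restriction of $\rho_e(g)$ to $\mathcal H_e^{\rm per}$ under this identification. *)

(* Defs.v *)
From HB Require Import structures.
From mathcomp Require Import all_boot all_order all_algebra.
From mathcomp Require Import ring lra.
From mathcomp Require Import boolp classical_sets functions fsbigop reals.

Set Implicit Arguments.
Unset Strict Implicit.
Unset Printing Implicit Defensive.

Import Order.TTheory GRing.Theory Num.Theory.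
Local Open Scope classical_set_scope.
Local Open Scope ring_scope.

(* Z^d is 'cV[int]_d and R^d is 'cV[R]_d; the norm that MathComp-Analysis puts *)
(* on matrices is the sup norm, hence the explicit Euclidean distance.         *)
Section Euclidean.
Variables (R : realType) (d : nat).
Implicit Types (x y p q : 'cV[R]_d) (f : 'cV[R]_d -> 'cV[R]_d).

Definition edist x y : R := Num.sqrt (\sum_(i < d) (x i 0 - y i 0) ^+ 2).

Definition isometry f : Prop :=
  bijective f /\ forall x y, edist (f x) (f y) = edist x y.

Definition segment p q : set 'cV[R]_d :=
  [set x | exists2 s : R, 0 <= s <= 1 & x = (1 - s) *: p + s *: q].

Definition std_basis (j : 'I_d) : 'cV[int]_d := delta_mx j 0.

Definition period_matrix (T : 'cV[int]_d -> 'cV[R]_d -> 'cV[R]_d) : 'M[R]_d :=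
  \matrix_(i, j) T (std_basis j) 0 i 0.

Definition intv (k : 'cV[int]_d) : 'cV[R]_d := map_mx intr k.

Record translation_group := TranslationGroup {
  transl :> 'cV[int]_d -> 'cV[R]_d -> 'cV[R]_d;
  transl_shift : forall k, exists a, forall x, transl k x = x + a;
  translD : forall k l, transl (k + l) = transl k \o transl l;
  transl_full_rank : row_free (period_matrix transl)^T }.

Definition periods (T : translation_group) : 'M[R]_d := period_matrix T.

Lemma periods_unit T : periods T \in unitmx.
Proof. by rewrite -unitmx_tr -row_free_unit transl_full_rank. Qed.

Lemma translE (T : translation_group) k x : T k x = x + periods T *m intv k.
Proof.
have TE l y : T l y = y + T l 0.
  by have [a Ta] := transl_shift T l; rewrite !Ta add0r.
have T0D l m : T (l + m) 0 = T l 0 + T m 0.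
  by rewrite translD /= TE addrC.
have T0N l : T (- l) 0 = - T l 0.
  have T00 : T 0 0 = 0.
    by apply: (addrI (T 0 0)); rewrite -T0D !addr0.
  by apply/eqP; rewrite -addr_eq0 -T0D addNr T00.
have T00 : T 0 0 = 0 by rewrite -(subrr 0) T0D T0N subrr.
have T0Mn l n : T (l *+ n) 0 = T l 0 *+ n.
  by elim: n => [|n IH]; rewrite ?mulr0n // !mulrS T0D IH.
have T0Mz l (n : int) : T (n *: l) 0 = n%:~R *: T l 0.
  case: n => n.
    by rewrite -[Posz n]intz scaler_int -pmulrn T0Mn scaler_int intz -pmulrn.
  rewrite NegzE scaleNr T0N mulrNz scaleNr.
  by rewrite -[Posz n.+1]intz scaler_int -pmulrn T0Mn scaler_int intz -pmulrn.
rewrite TE; congr (_ + _).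
have {1}-> : k = \sum_i k i 0 *: std_basis i.
  rewrite [LHS]matrix_sum_delta; apply: eq_bigr => i _.
  by rewrite big_ord1.
have -> (r : seq 'I_d) : T (\sum_(i <- r) k i 0 *: std_basis i) 0 =
    \sum_(i <- r) (k i 0)%:~R *: T (std_basis i) 0.
  elim: r => [|i r IH]; first by rewrite !big_nil.
  by rewrite !big_cons T0D IH T0Mz.
apply/colP=> i; rewrite summxE mxE; apply: eq_bigr => j _.
by rewrite !mxE mulrC.
Qed.

Let dot x y : R := \sum_i x i 0 * y i 0.

Let dotC x y : dot x y = dot y x.
Proof. by apply: eq_bigr => i _; rewrite mulrC. Qed.

Let dotDl x y z : dot (x + y) z = dot x z + dot y z.
Proof. by rewrite -big_split; apply: eq_bigr => i _; rewrite mxE mulrDl. Qed.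

Let dotZl a x y : dot (a *: x) y = a * dot x y.
Proof. by rewrite mulr_sumr; apply: eq_bigr => i _; rewrite mxE mulrA. Qed.

Let dotBl x y z : dot (x - y) z = dot x z - dot y z.
Proof. by rewrite dotDl -scaleN1r dotZl mulN1r. Qed.

Let dotBB x y : dot (x - y) (x - y) = dot x x + dot y y - 2 * dot x y.
Proof. by rewrite dotBl dotC dotBl (dotC y (x - y)) dotBl (dotC y x); ring. Qed.

Let dot0 x : dot x x = 0 -> x = 0.
Proof.
move=> /eqP; rewrite psumr_eq0 => [/allP x0|i _]; last by rewrite -expr2 sqr_ge0.
apply/colP=> i; rewrite mxE; have := x0 i (mem_index_enum i).
by rewrite /= -expr2 sqrf_eq0 => /eqP.
Qed.

Lemma isometry_affine f : isometry f ->
  exists2 B : 'M[R]_d, B \in unitmx & forall x v, f (x + v) = f x + B *m v.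
Proof.
case=> _ fI; have [L LfE] : exists L, forall v, L v = f v - f 0 by exists (fun v => f v - f 0).
have LBB x y : dot (L x - L y) (L x - L y) = dot (x - y) (x - y).
  have edistE a b : edist a b = Num.sqrt (dot (a - b) (a - b)).
    by congr Num.sqrt; apply: eq_bigr => i _; rewrite !mxE expr2.
  have dge0 a : 0 <= dot a a by apply: sumr_ge0 => i _; rewrite -expr2 sqr_ge0.
  have := fI x y; rewrite !edistE => /eqP; rewrite eqr_sqrt // => /eqP <-.
  by rewrite !LfE opprB addrA subrK.
have L0 : L 0 = 0 by rewrite LfE subrr.
have Lsq x : dot (L x) (L x) = dot x x by have := LBB x 0; rewrite L0 !subr0.
have Ldot x y : dot (L x) (L y) = dot x y.
  by have := LBB x y; rewrite (dotBB (L x)) (dotBB x) !Lsq; lra.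
have Llin a x y : L (a *: x + y) = a *: L x + L y.
  apply/eqP; rewrite -subr_eq0; apply/eqP/dot0.
  have NE z : dot (L z) (L (a *: x + y) - (a *: L x + L y)) = 0.
    by rewrite dotC dotBl dotDl dotZl !Ldot dotDl dotZl subrr.
  by rewrite dotBl dotDl dotZl !NE mulr0 addr0 subrr.
pose B : 'M[R]_d := \matrix_(i, j) L (delta_mx j 0) i 0.
have LE v : L v = B *m v.
  have {1}-> : v = \sum_i v i 0 *: delta_mx i 0.
    by rewrite [LHS]matrix_sum_delta; apply: eq_bigr => i _; rewrite big_ord1.
  have -> (r : seq 'I_d) : L (\sum_(i <- r) v i 0 *: delta_mx i 0) =
      \sum_(i <- r) v i 0 *: L (delta_mx i 0).
    elim: r => [|i r IH]; first by rewrite !big_nil.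
    by rewrite !big_cons Llin IH.
  apply/colP=> i; rewrite summxE mxE; apply: eq_bigr => j _.
  by rewrite !mxE mulrC.
exists B => [|x v]; last first.
  by apply: (addIr (- f 0)); rewrite -LfE addrAC -LfE !LE mulmxDr.
suff : B^T *m B = 1%:M by case/mulmx1_unit.
apply/matrixP=> i j; rewrite !mxE.
transitivity (dot (L (delta_mx i 0)) (L (delta_mx j 0))).
  by apply: eq_bigr => k _; rewrite !mxE.
rewrite Ldot /dot (bigD1 i) //= big1 => [|k /negPf ki].
  by rewrite !mxE !eqxx mul1r addr0 andbT.
by rewrite !mxE ki mul0r.
Qed.

End Euclidean.

Section Framework.
Variables (R : realType) (d : nat).

Record crystal_framework := CrystalFramework {
  translations : translation_group R d;
  num_vertices : nat;
  num_edges : nat;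
  num_vertices_gt0 : (0 < num_vertices)%N;
  motif_point : 'I_num_vertices -> 'cV[R]_d;
  (* the motif edge e is [p_{kappa,l}, p_{tau,l'}] with                       *)
  (* edge_fst e = (kappa, l) and edge_snd e = (tau, l')                       *)
  edge_fst : 'I_num_edges -> 'I_num_vertices * 'cV[int]_d;
  edge_snd : 'I_num_edges -> 'I_num_vertices * 'cV[int]_d;
  fpoint := fun c : 'I_num_vertices * 'cV[int]_d =>
    translations c.2 (motif_point c.1);
  fedge := fun r : 'I_num_edges * 'cV[int]_d =>
    translations r.2 @` segment (fpoint (edge_fst r.1)) (fpoint (edge_snd r.1));
  fpoint_inj : injective fpoint;
  fedge_inj : injective fedge;
  edge_length_gt0 :
    forall e, 0 < edist (fpoint (edge_fst e)) (fpoint (edge_snd e)) }.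

Variable C : crystal_framework.

Definition vlabel : choiceType := ('I_(num_vertices C) * 'cV[int]_d)%type.
Definition elabel : choiceType := ('I_(num_edges C) * 'cV[int]_d)%type.
Definition Hv : Type := vlabel -> 'cV[R]_d.
Definition He : Type := elabel -> R.

Local Notation nv := (num_vertices C).
Local Notation ne := (num_edges C).
Local Notation Z := (periods (translations C)).

Definition edge_vector (e : 'I_ne) : 'cV[R]_d :=
  fpoint (edge_fst e) - fpoint (edge_snd e).

Definition edge_exponent (e : 'I_ne) : 'cV[int]_d :=
  (edge_snd e).2 - (edge_fst e).2.

Definition rigidity_entry (r : elabel) (c : vlabel) (i : 'I_d) : R :=
  let: (e, k) := r in
  if c == ((edge_fst e).1, (edge_fst e).2 + k) then edge_vector e i 0
  else if c == ((edge_snd e).1, (edge_snd e).2 + k) then - edge_vector e i 0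
  else 0.

(* every row of the infinite rigidity matrix is finitely supported *)
Definition rigidity_map (u : Hv) : He := fun r =>
  \sum_(c \in [set: vlabel]) \sum_(i < d) rigidity_entry r c i * u c i 0.

(* The first coefficient vanishes if kappa = tau. The last d ^ 2 columns are   *)
(* grouped in d blocks of size d, the j-th one being delta_j v_e.             *)
Definition affine_rigidity_matrix : 'M[R]_(ne, nv * d + d * d) :=
  \matrix_(e < ne) row_mx
    (mxvec (\matrix_(kappa < nv, i < d)
      (((kappa == (edge_fst e).1)%:R - (kappa == (edge_snd e).1)%:R)
         * edge_vector e i 0)))
    (mxvec (\matrix_(j < d, i < d)
      ((edge_exponent e j 0)%:~R * edge_vector e i 0))).

Record space_group := SpaceGroup {
  sg_map :> 'cV[R]_d -> 'cV[R]_d;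
  sg_isometry : isometry sg_map;
  sg_points : sg_map @` range (@fpoint C) = range (@fpoint C);
  sg_edges : [set sg_map @` s | s in range (@fedge C)] = range (@fedge C) }.

HB.instance Definition _ := gen_eqMixin space_group.
HB.instance Definition _ := gen_choiceMixin space_group.

Lemma sg_map_inj (g h : space_group) : g =1 h -> g = h.
Proof.
case: g h => [f fi fp fe] [f' fi' fp' fe'] /= /funext ff'.
by subst f'; congr SpaceGroup; exact: Prop_irrelevance.
Qed.

Program Definition sg_one : space_group := @SpaceGroup id _ _ _.
Next Obligation. by split => //; exists id. Qed.
Next Obligation. exact: image_id. Qed.
Next Obligation.
rewrite -[RHS]image_id; congr image; apply/funext => s; exact: image_id.
Qed.

Program Definition sg_mul (g h : space_group) : space_group :=
  @SpaceGroup (g \o h) _ _ _.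
Next Obligation.
have [gb gi] := sg_isometry g; have [hb hi] := sg_isometry h.
by split=> [|x y /=]; [exact: bij_comp | rewrite gi hi].
Qed.
Next Obligation. by rewrite -image_comp !sg_points. Qed.
Next Obligation.
rewrite -[RHS](sg_edges g) -[in RHS](sg_edges h) [RHS]image_comp.
by apply: eq_imagel => s _ /=; rewrite image_comp.
Qed.

Lemma sg_inv_subproof (g : space_group) :
  exists f, cancel g f /\ cancel f g.
Proof. by have [[f gK fK] _] := sg_isometry g; exists f. Qed.

Definition sg_invmap (g : space_group) := sval (cid (sg_inv_subproof g)).

Lemma sg_mapK (g : space_group) : cancel g (sg_invmap g).
Proof. by rewrite /sg_invmap; case: cid => f []. Qed.

Lemma sg_invmapK (g : space_group) : cancel (sg_invmap g) g.
Proof. by rewrite /sg_invmap; case: cid => f []. Qed.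

Program Definition sg_inv (g : space_group) : space_group :=
  @SpaceGroup (sg_invmap g) _ _ _.
Next Obligation.
have [_ gi] := sg_isometry g; split=> [|x y].
  by exists g; [exact: sg_invmapK | exact: sg_mapK].
by rewrite -gi !sg_invmapK.
Qed.
Next Obligation.
rewrite -{1}(sg_points g) [LHS]image_comp -[RHS]image_id.
by apply: eq_imagel => x _ /=; exact: sg_mapK.
Qed.
Next Obligation.
rewrite -{1}(sg_edges g) [LHS]image_comp -[RHS]image_id.
apply: eq_imagel => s _ /=; rewrite image_comp -[RHS]image_id.
by apply: eq_imagel => x _ /=; exact: sg_mapK.
Qed.

Lemma sg_mulA : associative sg_mul.
Proof. by move=> g h k; apply: sg_map_inj. Qed.
Lemma sg_mul1g : left_id sg_one sg_mul.
Proof. by move=> g; apply: sg_map_inj. Qed.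
Lemma sg_mulg1 : right_id sg_one sg_mul.
Proof. by move=> g; apply: sg_map_inj. Qed.
Lemma sg_mulVg : left_inverse sg_one sg_inv sg_mul.
Proof. by move=> g; apply: sg_map_inj => x; exact: sg_mapK. Qed.
Lemma sg_mulgV : right_inverse sg_one sg_inv sg_mul.
Proof. by move=> g; apply: sg_map_inj => x; exact: sg_invmapK. Qed.

HB.instance Definition _ := isGroup.Build space_group
  sg_mulA sg_mul1g sg_mulg1 sg_mulVg sg_mulgV.

Implicit Types (g : space_group) (c : vlabel) (r : elabel).

Lemma sgVK g x : (g^-1)%g (g x) = x.
Proof. exact: sg_mapK. Qed.

Lemma sgKV g x : g ((g^-1)%g x) = x.
Proof. exact: sg_invmapK. Qed.

Lemma vact_subproof g c : exists c', fpoint c' = g (fpoint c).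
Proof.
have : (g @` range (@fpoint C)) (g (fpoint c)) by exists (fpoint c) => //; exists c.
by rewrite sg_points => -[c' _ <-]; exists c'.
Qed.

Definition vact g c : vlabel := sval (cid (vact_subproof g c)).

Lemma fpoint_vact g c : fpoint (vact g c) = g (fpoint c).
Proof. by rewrite /vact; case: cid. Qed.

Lemma eact_subproof g r : exists r', fedge r' = g @` fedge r.
Proof.
have : [set g @` s | s in range (@fedge C)] (g @` fedge r).
  by exists (fedge r) => //; exists r.
by rewrite sg_edges => -[r' _ <-]; exists r'.
Qed.

Definition eact g r : elabel := sval (cid (eact_subproof g r)).

Lemma fedge_eact g r : fedge (eact g r) = g @` fedge r.
Proof. by rewrite /eact; case: cid. Qed.

Definition semiseparable g : Prop :=
  exists s : 'I_nv -> 'I_nv, forall c, (vact g c).1 = s c.1.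

Definition rho_v g (u : Hv) : Hv := fun c => g (u (vact g^-1%g c)).
Definition rho_e g (w : He) : He := fun r => w (eact g^-1%g r).

Definition affine_vector (u : 'I_nv -> 'cV[R]_d) (A : 'M[R]_d) : Hv :=
  fun c => u c.1 - A *m Z *m intv R c.2.

Definition is_affine (v : Hv) : Prop := exists u A, v = affine_vector u A.

Definition Hv_aff : Type := {v : Hv | is_affine v}.

Definition is_periodic (w : He) : Prop := forall e k, w (e, k) = w (e, 0).

Definition He_per : Type := {w : He | is_periodic w}.

(* (u, AZ) as one vector: the |F_v| blocks u_kappa, then the d columns of AZ  *)
Definition pack (u : 'I_nv -> 'cV[R]_d) (AZ : 'M[R]_d) : 'cV[R]_(nv * d + d * d) :=
  col_mx (mxvec (\matrix_(kappa, i) u kappa i 0))^T (mxvec AZ^T)^T.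

Definition unpack1 (x : 'cV[R]_(nv * d + d * d)) (kappa : 'I_nv) : 'cV[R]_d :=
  \col_i vec_mx (usubmx x)^T kappa i.

Definition unpack2 (x : 'cV[R]_(nv * d + d * d)) : 'M[R]_d :=
  (vec_mx (dsubmx x)^T)^T.

Lemma pack1K u M : unpack1 (pack u M) = u.
Proof.
apply/funext => kappa; apply/colP => i.
by rewrite mxE col_mxKu trmxK mxvecK mxE.
Qed.

Lemma pack2K u M : unpack2 (pack u M) = M.
Proof. by rewrite /unpack2 col_mxKd trmxK mxvecK trmxK. Qed.

Lemma unpackK x : pack (unpack1 x) (unpack2 x) = x.
Proof.
rewrite -[RHS]vsubmxK /pack /unpack2 trmxK vec_mxK trmxK; congr (col_mx _ _).
rewrite -[RHS]trmxK; congr (_^T); rewrite -[RHS]vec_mxK; congr mxvec.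
by apply/matrixP=> i j; rewrite !mxE.
Qed.

Lemma intv0 : intv R (0 : 'cV[int]_d) = 0.
Proof. exact: map_mx0. Qed.

Lemma affine_vector_inj u A u' A' :
  affine_vector u A = affine_vector u' A' -> u = u' /\ A = A'.
Proof.
move=> E; have uu' : u = u'.
  apply/funext => kappa; have := congr1 (@^~ (kappa, 0)) E.
  by rewrite /affine_vector /= intv0 !mulmx0 !subr0.
split=> //; apply: (can_inj (mulmxK (periods_unit (translations C)))).
apply/matrixP => i j.
have := congr1 (fun v : Hv => v (Ordinal (num_vertices_gt0 C), std_basis j) i 0) E.
rewrite /affine_vector uu' !mxE /= => /addrI /oppr_inj.
have sumE (M : 'M[R]_d) : \sum_k M i k * intv R (std_basis j) k 0 = M i j.
  rewrite (bigD1 j) //= big1 => [|k /negPf kj]; last by rewrite !mxE kj mulr0.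
  by rewrite !mxE !eqxx mulr1 addr0.
by rewrite !sumE !mxE.
Qed.

Definition affine_coord (v : Hv_aff) : 'cV[R]_(nv * d + d * d) :=
  let: exist u uA := cid (svalP v) in
  let: exist A _ := cid uA in pack u (A *m Z).

Definition affine_coord_inv (x : 'cV[R]_(nv * d + d * d)) : Hv_aff :=
  let u := unpack1 x in let A := unpack2 x *m invmx Z in
  exist _ (affine_vector u A) (ex_intro _ u (ex_intro _ A erefl)).


Lemma affine_coordE u A (h : is_affine (affine_vector u A)) :
  affine_coord (exist _ _ h) = pack u (A *m Z).
Proof.
rewrite /affine_coord; case: cid => u' h'; case: cid => A' /= /affine_vector_inj [<- <-].
by [].
Qed.

Lemma affine_coord_invK : cancel affine_coord_inv affine_coord.
Proof.
move=> x; rewrite /affine_coord_inv affine_coordE mulmxKV ?unpackK //.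
exact: periods_unit.
Qed.

Lemma affine_coordK : cancel affine_coord affine_coord_inv.
Proof.
case=> v [u [A Ev]]; subst v; rewrite affine_coordE; apply: eq_exist => /=.
by rewrite pack1K pack2K mulmxK // periods_unit.
Qed.

Lemma vactK g : cancel (vact g) (vact g^-1%g).
Proof. by move=> c; apply: fpoint_inj; rewrite !fpoint_vact sgVK. Qed.

Lemma vactVK g : cancel (vact g^-1%g) (vact g).
Proof. by move=> c; apply: fpoint_inj; rewrite !fpoint_vact sgKV. Qed.

Lemma semiseparableV g : semiseparable g -> semiseparable g^-1%g.
Proof.
case=> s sE.
have s_surj kappa : exists kappa', s kappa' = kappa.
  exists (vact g^-1%g (kappa, 0)).1.
  by rewrite -sE vactVK.
have [s' s'K] : exists s', cancel s' s.
  by exists (fun kappa => sval (cid (s_surj kappa))) => kappa; case: cid.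
have sI : bijective s' by apply: injF_bij; exact: can_inj s'K.
exists s' => c; apply: (bij_inj (bij_can_bij sI s'K)).
by rewrite s'K -sE vactVK.
Qed.

Lemma fpointD kappa k l :
  @fpoint C (kappa, k + l) = fpoint (kappa, k) + Z *m intv R l.
Proof. by rewrite /fpoint /= !translE /intv map_mxD mulmxDr addrA. Qed.

(* the linear part of a semiseparable symmetry preserves the period lattice *)
Lemma semiseparable_lattice g B : semiseparable g ->
  (forall x v, g (x + v) = g x + B *m v) ->
  forall k, exists l, B *m (Z *m intv R k) = Z *m intv R l.
Proof.
case=> s sE gB k; pose kappa := Ordinal (num_vertices_gt0 C).
have E l : vact g (kappa, l) = (s kappa, (vact g (kappa, l)).2).
  by rewrite [LHS]surjective_pairing sE.
exists ((vact g (kappa, k)).2 - (vact g (kappa, 0)).2).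
apply: (addrI (g (fpoint (kappa, 0)))); rewrite -gB -fpointD add0r.
by rewrite -!fpoint_vact (E k) (E 0) -fpointD /= addrC subrK.
Qed.

Lemma rho_v_affine g (v : Hv) : semiseparable g ->
  is_affine v -> is_affine (rho_v g v).
Proof.
move=> sg [u [A ->]].
have [B Bu gB] := isometry_affine (sg_isometry g).
have gVB x w : (g^-1)%g (x + w) = (g^-1)%g x + invmx B *m w.
  by apply: (can_inj (sgVK g)); rewrite gB !sgKV mulKVmx.
have [s sE] := semiseparableV sg.
exists (fun kappa => rho_v g (affine_vector u A) (kappa, 0)), (B *m A *m invmx B).
apply/funext => -[kappa k]; rewrite /rho_v /affine_vector /= !sE /=.
have E l : vact g^-1%g (kappa, l) = (s kappa, (vact g^-1%g (kappa, l)).2).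
  by rewrite [LHS]surjective_pairing sE.
have Zk : Z *m intv R (vact g^-1%g (kappa, k)).2 =
    Z *m intv R (vact g^-1%g (kappa, 0)).2 + invmx B *m (Z *m intv R k).
  apply: (addrI (fpoint (s kappa, 0))); rewrite addrA -!fpointD !add0r -!E.
  by rewrite !fpoint_vact -gVB -fpointD add0r.
by rewrite -!mulmxA Zk !mulmxDr opprD addrA [LHS]gB mulmxN.
Qed.

Lemma fedgeD e k l :
  @fedge C (e, k + l) = (fun x => x + Z *m intv R l) @` fedge (e, k).
Proof.
rewrite /fedge image_comp; apply: eq_imagel => x _ /=.
by rewrite !translE /intv map_mxD mulmxDr addrA.
Qed.

Lemma rho_e_periodic g (w : He) : semiseparable g ->
  is_periodic w -> is_periodic (rho_e g w).
Proof.
move=> /semiseparableV sg wper e k; rewrite /rho_e.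
have [B _ gB] := isometry_affine (sg_isometry g^-1%g).
have [l lE] := semiseparable_lattice sg gB k.
set r0 := eact _ (e, 0).
suff -> : eact g^-1%g (e, k) = (r0.1, r0.2 + l).
  by rewrite wper [r0 in RHS]surjective_pairing wper.
apply: fedge_inj; rewrite fedgeD -surjective_pairing !fedge_eact.
rewrite -[k]add0r fedgeD !image_comp; apply: eq_imagel => x _ /=.
by rewrite -lE; exact: gB.
Qed.

Definition rho_v_aff g (sg : semiseparable g) (v : Hv_aff) : Hv_aff :=
  exist _ (rho_v g (sval v)) (rho_v_affine sg (svalP v)).

Definition rho_e_per g (sg : semiseparable g) (w : He_per) : He_per :=
  exist _ (rho_e g (sval w)) (rho_e_periodic sg (svalP w)).

Definition per_col (w : He_per) : 'cV[R]_ne := \col_e sval w (e, 0).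

Definition per_col_inv (x : 'cV[R]_ne) : He_per :=
  exist is_periodic (fun r => x r.1 0) (fun e k => erefl).

Lemma per_colK : cancel per_col per_col_inv.
Proof.
case=> w wper; apply: eq_exist; apply/funext => -[e k] /=.
by rewrite mxE /= wper.
Qed.

Lemma per_col_invK : cancel per_col_inv per_col.
Proof. by move=> x; apply/colP => e; rewrite mxE. Qed.

Definition pi_v g (sg : semiseparable g) :
    'cV[R]_(nv * d + d * d) -> 'cV[R]_(nv * d + d * d) :=
  affine_coord \o rho_v_aff sg \o affine_coord_inv.

Definition pi_e g (sg : semiseparable g) : 'cV[R]_ne -> 'cV[R]_ne :=
  per_col \o rho_e_per sg \o per_col_inv.

End Framework.

Arguments rigidity_map {R d} C.
Arguments affine_rigidity_matrix {R d} C.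

(* Main.v *)
Require Import Defs.
From HB Require Import structures.
From mathcomp Require Import all_boot all_order all_algebra.
From mathcomp Require Import ring lra.
From mathcomp Require Import boolp classical_sets functions fsbigop reals.

Set Implicit Arguments.
Unset Strict Implicit.
Unset Printing Implicit Defensive.

Import Order.TTheory GRing.Theory Num.Theory.
Local Open Scope ring_scope.

(** The infinite rigidity matrix has an orientation-free description: for an
    edge with end points [p_a] and [p_b],
      [(R u)_{ab} = <p_a - p_b, u_a - u_b>],
    and this scalar is unchanged when [a] and [b] are exchanged. A space group
    element [g] permutes the framework edges as point sets, and a segment has
    only two extreme points, so the end points of the image edge are the images
    of the end points, in one of the two orders. As [g] is an isometry, it
    preserves inner products of differences ([isometry_dot]); its translation
    part cancels in the differences. Hence evaluating [R u] on [g^-1 (ab)] is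
    the same as evaluating [R (rho_v g u)] on [ab], which is the first part
    ([rho_e_rigidity_map]).

    For the second part, an affinely periodic displacement
    [u_kappa - A Z k] has the difference [u_kappa - u_tau + A Z delta(e)] along
    the edge [(e, k)], whatever [k] is. So the affinely periodic rigidity matrix
    is the restriction of [R] to these displacements, read in coordinates
    ([affine_rigidity_matrixE]), and the second intertwining relation is the
    restriction of the first one. *)

(** * Isometries and segments *)

Section Geometry.
Variables (R : realType) (d : nat).
Implicit Types (p q x y z w : 'cV[R]_d) (f : 'cV[R]_d -> 'cV[R]_d).

Definition dot x y : R := (x^T *m y) 0 0.

Lemma dotC x y : dot x y = dot y x.
Proof. by rewrite /dot -[in LHS](trmxK y) -trmx_mul mxE. Qed.

Lemma dotDl x y z : dot (x + y) z = dot x z + dot y z.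
Proof. by rewrite /dot linearD mulmxDl mxE. Qed.

Lemma dotNl x z : dot (- x) z = - dot x z.
Proof. by rewrite /dot linearN mulNmx mxE. Qed.

Lemma dotNr x z : dot x (- z) = - dot x z.
Proof. by rewrite dotC dotNl dotC. Qed.

Lemma dotE x y : dot x y = \sum_i x i 0 * y i 0.
Proof. by rewrite /dot mxE; apply: eq_bigr => i _; rewrite mxE. Qed.

Lemma dot_ge0 x : 0 <= dot x x.
Proof. by rewrite dotE sumr_ge0 // => i _; rewrite -expr2 sqr_ge0. Qed.

Lemma edistE x y : edist x y = Num.sqrt (dot (x - y) (x - y)).
Proof.
by rewrite dotE; congr Num.sqrt; apply: eq_bigr => i _; rewrite !mxE expr2.
Qed.

(** Polarization turns the preservation of distances into that of inner
    products of differences. *)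
Lemma isometry_dot f x y z w : Defs.isometry f ->
  dot (f x - f y) (f z - f w) = dot (x - y) (z - w).
Proof.
move=> fiso; have [B _ fB] := isometry_affine fiso; have [_ fd] := fiso.
have fBE a b : f a - f b = B *m (a - b).
  by rewrite -{1}(subrKC b a) fB addrC addKr.
have normB v : dot (B *m v) (B *m v) = dot v v.
  apply/eqP; have := fd v 0.
  by rewrite !edistE fBE subr0 => /eqP; rewrite eqr_sqrt ?dot_ge0.
have dotDD a b : dot (a + b) (a + b) = dot a a + dot b b + 2 * dot a b.
  by rewrite dotDl ![dot _ (a + b)]dotC !dotDl (dotC b a); ring.
rewrite !fBE; have := dotDD (B *m (x - y)) (B *m (z - w)).
by rewrite -mulmxDr !normB (dotDD (x - y)); lra.
Qed.

Lemma segmentC p q : segment p q = segment q p.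
Proof.
by apply/seteqP; split=> x [s s01 ->]; exists (1 - s);
  rewrite ?subKr 1?addrC //; lra.
Qed.

Lemma segment_left p q : segment p q p.
Proof. by exists 0; rewrite ?lexx ?ler01 // subr0 scale1r scale0r addr0. Qed.

Lemma image_segment f (B : 'M[R]_d) p q : (forall x v, f (x + v) = f x + B *m v) ->
  (f @` segment p q)%classic = segment (f p) (f q).
Proof.
move=> fB.
have fE s : f ((1 - s) *: p + s *: q) = (1 - s) *: f p + s *: f q.
  have -> : (1 - s) *: p + s *: q = p + s *: (q - p).
    by rewrite scalerBl scale1r scalerBr addrAC addrA.
  have -> : f q = f p + B *m (q - p) by rewrite -fB subrKC.
  by rewrite fB -scalemxAr scalerDr addrA -scalerDl subrK scale1r.
apply/seteqP; split=> x.
  by move=> [y [s s01 ->] <-]; exists s.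
by move=> [s s01 ->]; exists ((1 - s) *: p + s *: q) => //; exists s.
Qed.

(** End points are extreme points: [p] is a convex combination of [p'] and [q'],
    which are themselves points of [segment p q], and this forces [p] to be one
    of the two. *)
Lemma segment_extreme p q p' q' : segment p q = segment p' q' ->
  p = p' \/ p = q'.
Proof.
move=> E.
have [s /andP[s0 s1] ps] : segment p' q' p by rewrite -E; exact: segment_left.
have [a /andP[a0 a1] p'a] : segment p q p' by rewrite E; exact: segment_left.
have [b /andP[b0 b1] q'b] : segment p q q'.
  by rewrite E segmentC; exact: segment_left.
have onE t : (1 - t) *: p + t *: q = p + t *: (q - p).
  by rewrite scalerBl scale1r scalerBr addrAC addrA.
rewrite onE in p'a; rewrite onE in q'b.
(* Along the direction [q - p] from [p], the points [p'] and [q'] lie at the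
   parameters [a] and [b], whose mean with weights [1 - s] and [s] is that of
   [p], namely 0; all terms are nonnegative, so each of them vanishes. *)
have : ((1 - s) * a + s * b) *: (q - p) = 0.
  apply: (addrI p); rewrite addr0 [RHS]ps p'a q'b 2!(scalerDr _ p) addrACA.
  by rewrite -scalerDl subrK scale1r !scalerA scalerDl.
move/eqP; rewrite scaler_eq0 => /orP[|/eqP qp]; last first.
  by left; rewrite p'a qp scaler0 addr0.
have sa0 : 0 <= (1 - s) * a by rewrite mulr_ge0 // subr_ge0.
rewrite paddr_eq0 ?sa0 ?mulr_ge0 // !mulf_eq0 => /andP[].
case/orP=> [/eqP s1E|/eqP aE]; last by left; rewrite p'a aE scale0r addr0.
case/orP=> [/eqP sE|/eqP bE]; first by move/eqP: s1E; rewrite sE subr0 oner_eq0.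
by right; rewrite q'b bE scale0r addr0.
Qed.

Lemma segment_endpoints p q p' q' : segment p q = segment p' q' ->
  p = p' /\ q = q' \/ p = q' /\ q = p'.
Proof.
move=> E; have [pE|pE] := segment_extreme E.
  have [qE|qE] := segment_extreme (etrans (segmentC q p) E); last by left.
  have [] := segment_extreme (etrans (segmentC q' p') (esym E)) => q'E.
    by left; rewrite pE qE q'E pE.
  by left; rewrite q'E.
have [qE|qE] := segment_extreme (etrans (segmentC q p) E); first by right.
by have [] := segment_extreme (esym E) => p'E; right; rewrite qE p'E ?pE ?qE.
Qed.

End Geometry.

(** * The rigidity matrix and its symmetries *)

Section Framework.
Variables (R : realType) (d : nat) (C : crystal_framework R d).
Implicit Types (g : space_group C) (r : elabel C) (u : Hv C).

Definition edge_src r : vlabel C := ((edge_fst r.1).1, (edge_fst r.1).2 + r.2).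
Definition edge_tgt r : vlabel C := ((edge_snd r.1).1, (edge_snd r.1).2 + r.2).

Lemma fpoint_shift (c : vlabel C) k :
  @fpoint R d C (c.1, c.2 + k) =
  fpoint c + periods (translations C) *m intv R k.
Proof. by case: c => kappa l; exact: fpointD. Qed.

Lemma fedge_segment r :
  fedge r = segment (fpoint (edge_src r)) (fpoint (edge_tgt r)).
Proof.
rewrite /fedge (@image_segment _ _ _ 1%:M) => [|x v].
  by rewrite !fpoint_shift !translE.
by rewrite !translE mul1mx addrAC.
Qed.

Lemma edge_vectorE r :
  edge_vector r.1 = fpoint (edge_src r) - fpoint (edge_tgt r).
Proof. by rewrite !fpoint_shift opprD addrACA subrr addr0. Qed.

Lemma edge_src_tgt r : edge_src r != edge_tgt r.
Proof.
apply/eqP => st; have := edge_length_gt0 r.1.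
have := edge_vectorE r; rewrite st subrr /edge_vector edistE => ->.
by rewrite /dot trmx0 mul0mx mxE sqrtr0 ltxx.
Qed.

(** Written with the end points themselves instead of the chosen edge vector,
    the row of an edge is visibly invariant under exchanging its end points. *)
Lemma rigidity_mapE u r : rigidity_map C u r =
  dot (fpoint (edge_src r) - fpoint (edge_tgt r)) (u (edge_src r) - u (edge_tgt r)).
Proof.
have ts : (edge_tgt r == edge_src r) = false.
  by rewrite eq_sym; apply: negPf; exact: edge_src_tgt.
have entryE c i : rigidity_entry r c i =
    if c == edge_src r then edge_vector r.1 i 0
    else if c == edge_tgt r then - edge_vector r.1 i 0 else 0.
  by case: (r).
rewrite -edge_vectorE /rigidity_map.
rewrite (@fsbigE _ _ _ _ _ [:: edge_src r; edge_tgt r]) //=; last 2 first.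
- by rewrite inE edge_src_tgt.
- move=> c _; rewrite !inE negb_or => /andP[/negPf cs /negPf ct].
  by apply: big1 => i _; rewrite entryE cs ct mul0r.
rewrite !big_cons big_nil !in_setT addr0 -big_split /= dotE.
apply: eq_bigr => i _.
by rewrite !entryE !eqxx ts !mxE; ring.
Qed.

Lemma eact_endpoints g r :
  edge_src (eact g r) = vact g (edge_src r) /\
    edge_tgt (eact g r) = vact g (edge_tgt r) \/
  edge_src (eact g r) = vact g (edge_tgt r) /\
    edge_tgt (eact g r) = vact g (edge_src r).
Proof.
have [B _ gB] := isometry_affine (sg_isometry g).
have := fedge_eact g r; rewrite !fedge_segment (image_segment _ _ gB).
rewrite -!fpoint_vact => /segment_endpoints.
by case=> -[/fpoint_inj-> /fpoint_inj->]; [left|right].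
Qed.

Lemma rho_e_rigidity_map g u :
  rho_e g (rigidity_map C u) = rigidity_map C (rho_v g u).
Proof.
apply/funext => r; rewrite /rho_e !rigidity_mapE.
transitivity (dot (fpoint (vact g^-1%g (edge_src r)) -
                   fpoint (vact g^-1%g (edge_tgt r)))
    (u (vact g^-1%g (edge_src r)) - u (vact g^-1%g (edge_tgt r)))).
  case: (eact_endpoints g^-1%g r) => -[-> ->] //.
  by rewrite -opprB dotNl -dotNr opprB.
by rewrite -(isometry_dot _ _ _ _ (sg_isometry g)) -!fpoint_vact !vactVK.
Qed.

(** Both vertex and lattice blocks of the row of [e] are of rank one, so the row
    pairs with [(u, AZ)] as [<v_e, u_kappa - u_tau + A Z delta(e)>]. *)
Lemma affine_rigidity_matrix_pack (u : 'I_(num_vertices C) -> 'cV[R]_d)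
    (M : 'M[R]_d) e :
  (affine_rigidity_matrix C *m pack u M) e 0 =
  dot (edge_vector e) (u (edge_fst e).1 - u (edge_snd e).1
                       + M *m intv R (edge_exponent e)).
Proof.
set kappa := (edge_fst e).1; set tau := (edge_snd e).1.
(* [mxvec_dotmul] evaluates the pairing of a flattened rank-one matrix [a^T v]
   with a flattened matrix [U] as the bilinear form [a U v^T]. *)
pose a : 'rV[R]_(num_vertices C) := delta_mx 0 kappa - delta_mx 0 tau.
have block_rowE : row e (affine_rigidity_matrix C) =
    row_mx (mxvec (a^T *m (edge_vector e)^T))
           (mxvec (intv R (edge_exponent e) *m (edge_vector e)^T)).
  rewrite /affine_rigidity_matrix rowK; congr (row_mx (mxvec _) (mxvec _));
    apply/matrixP => i j; rewrite !mxE big_ord1 !mxE //.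
have -> : (affine_rigidity_matrix C *m pack u M) e 0 =
    (row e (affine_rigidity_matrix C) *m pack u M) 0 0.
  by rewrite -row_mul [RHS]mxE.
rewrite block_rowE /pack mul_row_col mxvec_dotmul -[intv R _]trmxK mxvec_dotmul.
rewrite !trmxK -mulmxDl dotC /dot; congr ((_ *m _) 0 0).
rewrite linearD /= trmx_mul; congr (_ + _).
by rewrite /a mulmxBl -!rowE; apply/rowP => i; rewrite !mxE.
Qed.

(** The lattice vector [k] cancels in the difference of an affinely periodic
    displacement along [(e, k)]; only the exponent of [e] survives. *)
Lemma affine_rigidity_matrixE (v : Hv_aff C) e k :
  (affine_rigidity_matrix C *m affine_coord v) e 0 = rigidity_map C (sval v) (e, k).
Proof.
case: v => v [u [A vE]]; subst v; rewrite affine_coordE.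
rewrite affine_rigidity_matrix_pack rigidity_mapE -edge_vectorE /=.
congr dot; rewrite /affine_vector /= /edge_exponent /intv.
rewrite !map_mxD map_mxN !mulmxDr mulmxN.
by apply/colP => i; rewrite !mxE; ring.
Qed.

Lemma pi_e_affine_rigidity_matrix g (sg : semiseparable g) :
  pi_e sg \o mulmx (affine_rigidity_matrix C) =
  mulmx (affine_rigidity_matrix C) \o pi_v sg.
Proof.
apply/funext => x; rewrite -[x]affine_coord_invK.
move: (affine_coord_inv x) => v; rewrite /pi_e /pi_v /= affine_coordK.
apply/colP => e; rewrite (affine_rigidity_matrixE _ e 0) mxE /=.
rewrite -rho_e_rigidity_map; congr (rho_e g _ _).
by apply/funext => -[e' k]; rewrite /= (affine_rigidity_matrixE v e' k).
Qed.

End Framework.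

Theorem theorem3p2 (R : realType) (d : nat) (C : crystal_framework R d) :
  (forall g : space_group C,
     rho_e g \o rigidity_map C = rigidity_map C \o rho_v g) /\
  (forall (G : groupClosed (space_group C))
     (G_semisep : forall g : space_group C, g \in G -> semiseparable g)
     (g : space_group C) (gG : g \in G),
     pi_e (G_semisep g gG) \o mulmx (affine_rigidity_matrix C) =
     mulmx (affine_rigidity_matrix C) \o pi_v (G_semisep g gG)).
Proof.
split=> [g|G G_semisep g gG]; last exact: pi_e_affine_rigidity_matrix.
by apply/funext => u; exact: rho_e_rigidity_map.
Qed.
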